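(* Let $\mathbb{P}_{\mathbf{K}_4}$ be the symplectic sine-process, that is, the Pfaffian point process on $\mathbb{R}$ with correlation functions $\rho_n(x_1,\dots,x_n)=\mathrm{Pf}(\mathbf{K}_4(x_i,x_j))_{i,j=1,\dots,n}$, and let $I\subset\mathbb{R}$ be an interval of length $1$. Then there exists a constant $c_1>0$ such that for all $\lambda>0$ we have $$\mathbb{E}_{\mathbb{P}_{\mathbf{K}_4}}e^{\lambda\#_I^2}\le\exp\bigl(c_1(\exp(\lambda)-1)\bigr).$$
   Context: Let $S(t)=\frac{\sin\pi t}{\pi t}$ (with $S(0)=1$), $DS(t)=\frac{dS}{dt}(t)$, $IS(t)=\int_0^tS(u)\,du$, and $$\mathbf{K}_4(x,y)=\frac12\begin{pmatrix}-IS(x-y)&S(x-y)\\-S(x-y)&DS(x-y)\end{pmatrix}.$$ It satisfies $\mathbf{K}_4(x,y)=-\mathbf{K}_4(y,x)^\top$, so the $2n\times2n$ block matrix $(\mathbf{K}_4(x_i,x_j))_{i,j=1,\dots,n}$ is antisymmetric; $\mathrm{Pf}$ denotes its Pfaffian. Correlation functions are with respect to Lebesgue measure. $\#_I$ is the number of particles of the configuration in $I$. *)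

(* Defs.v *)
From HB Require Import structures.
From mathcomp Require Import all_boot all_order all_algebra all_fingroup.
From mathcomp Require Import finmap.
From mathcomp Require Import all_classical all_reals all_analysis.
Set Implicit Arguments.
Unset Strict Implicit.
Unset Printing Implicit Defensive.
Import Order.TTheory GRing.Theory Num.Theory numFieldNormedType.Exports.
Local Open Scope classical_set_scope.
Local Open Scope ring_scope.

Section Pfaffian.
Context {F : numFieldType}.

Lemma evenI_subproof n (k : 'I_n) : (k.*2 < n.*2)%N.
Proof. by rewrite ltn_double. Qed.

Lemma oddI_subproof n (k : 'I_n) : (k.*2.+1 < n.*2)%N.
Proof. by rewrite ltn_Sdouble. Qed.

Definition evenI n (k : 'I_n) : 'I_n.*2 := Ordinal (evenI_subproof k).
Definition oddI n (k : 'I_n) : 'I_n.*2 := Ordinal (oddI_subproof k).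

(* Pf A = (1 / (2^n n!)) \sum_s sgn(s) \prod_k A_{s(2k), s(2k+1)}, indices from 0;
   it is the Pfaffian for antisymmetric A. *)
Definition Pf n (A : 'M[F]_n.*2) : F :=
  ((2 ^ n * n`!)%N%:R)^-1 *
  \sum_(s : 'S_n.*2) (-1) ^+ s * \prod_(k < n) A (s (evenI k)) (s (oddI k)).

End Pfaffian.

Section Kernel.
Context {R : realType}.

Definition Sfun (t : R) : R := if t == 0 then 1 else sin (pi * t) / (pi * t).

Definition DSfun (t : R) : R := derive1 Sfun t.

Definition ISfun (t : R) : R :=
  if 0 <= t then \int[lebesgue_measure]_(u in `[0, t]) Sfun u
  else - \int[lebesgue_measure]_(u in `[t, 0]) Sfun u.

Definition K4 (x y : R) : 'M[R]_(1 + 1) :=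
  2^-1 *: block_mx (- ISfun (x - y))%:M (Sfun (x - y))%:M
                   (- Sfun (x - y))%:M  (DSfun (x - y))%:M.

(* The 2n x 2n matrix with 2 x 2 blocks K4 x_a x_b: row i lies in block row
   i./2, at position i mod 2 inside that block. *)
Definition K4_mx n (x : n.-tuple R) : 'M[R]_n.*2 :=
  \matrix_(i, j) K4 x`_i./2 x`_j./2 (inord (odd i)) (inord (odd j)).

End Kernel.

(* Locally finite subsets of the line: particles have no multiplicities. *)
Record conf (R : realType) := Conf {
  conf_set :> set R ;
  conf_locally_finite : forall K : set R, compact K ->
    finite_set (conf_set `&` K) }.

HB.instance Definition _ (R : realType) := gen_eqMixin (conf R).
HB.instance Definition _ (R : realType) := gen_choiceMixin (conf R).

Lemma conf0_subproof (R : realType) (K : set R) : compact K ->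
  finite_set (set0 `&` K).
Proof. by move=> _; rewrite set0I; exact: finite_set0. Qed.

HB.instance Definition _ (R : realType) :=
  isPointed.Build (conf R) (Conf (@conf0_subproof R)).

Section PointProcess.
Context {R : realType}.

(* fset_set sends infinite sets to the empty one, so this is the number of
   particles in B only if that number is finite, e.g. if B is bounded. *)
Definition npart (B : set R) (X : conf R) : nat := #|` fset_set (X `&` B)|.

Definition conf_cylinders : set (set (conf R)) :=
  [set C | exists (B : set R) (k : nat), [/\ measurable B, bounded_set B &
                           C = [set X | npart B X = k]]].

(* The sigma-algebra generated by the counting maps npart B, B bounded Borel. *)
Definition confM := g_sigma_algebraType conf_cylinders.

Definition distinct_tuples n (X : conf R) : set (n.-tuple R) :=
  [set x : n.-tuple R | uniq x /\ forall i, conf_set X (tnth x i)].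

(* The Lebesgue integral over R^n, written as an iterated integral; by Tonelli the
   two agree for nonnegative measurable integrands. *)
Fixpoint iter_integral n : (n.-tuple R -> \bar R) -> \bar R :=
  if n is m.+1 then fun f =>
    (\int[lebesgue_measure]_x
       iter_integral (fun y : m.-tuple R => f [tuple of x :: y]))%E
  else fun f => f [tuple].

(* E \sum f(x_1, ..., x_n) = \int f rho_n, the sum running over the n-tuples of
   pairwise distinct particles. *)
Definition has_correlation_functions (P : probability confM R)
    (rho : forall n, n.-tuple R -> R) : Prop :=
  forall n (f : n.-tuple R -> R),
    measurable_fun [set: n.-tuple R] f -> (forall x, 0 <= f x) ->
    (\int[P]_X (\esum_(x in distinct_tuples X) (f x)%:E) =
     iter_integral (fun x => (f x * rho n x)%:E))%E.

Definition symplectic_sine_process (P : probability confM R) : Prop :=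
  has_correlation_functions P (fun n x => Pf (K4_mx x)).

End PointProcess.
Arguments confM : clear implicits.

(* Main.v *)
Require Import Defs.
From HB Require Import structures.
From mathcomp Require Import all_boot all_order all_algebra all_fingroup.
From mathcomp Require Import finmap.
From mathcomp Require Import all_classical all_reals all_analysis.
From mathcomp Require Import measurable_realfun ring lra zify.
Set Implicit Arguments.
Unset Strict Implicit.
Unset Printing Implicit Defensive.
Import Order.TTheory GRing.Theory Num.Theory numFieldNormedType.Exports.
Local Open Scope classical_set_scope.
Local Open Scope ring_scope.

(* The kernel is built from IS and its derivatives, so K4_mx x is a limit of matrices
   V g V^T in which the rows of V are the Taylor monomials t^p / p! and their
   derivatives at the points x_i, recentred so that |t| <= 1, and g carries the
   Taylor coefficients.
   Expanding the Pfaffian multilinearly, only terms with 2n distinct exponents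
   survive, and each is at most C^(n^2) / (0! 1! ... (2n-1)!).  Hence
   rho_n <= D^(n^2) / (n^2)! on I^n, which also bounds P(#_I = n).
   With y = e^lambda and a_j = D^j / j!, and since P(#_I = k) <= a_(k^2),
     E y^(#_I^2) <= 1 + sum_j (y^j - 1) a_j = 1 + e^D (e^(D (y - 1)) - 1),
   and Bernoulli's inequality turns the right-hand side into exp(c (y - 1)). *)

(** * Expansion of the Pfaffian of V g V^T over pairs of columns *)

Lemma prod_double (F : comPzSemiRingType) n (h : 'I_n.*2 -> F) :
  \prod_i h i = \prod_(k < n) (h (evenI k) * h (oddI k)).
Proof.
(* Extending [h] by 1 to all of [nat] frees its type from [n], which makes an induction on [n]
   possible. *)
pose h' j := oapp h 1 (insub j).
have h'E (i : 'I_n.*2) : h i = h' i by rewrite /h' valK.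
rewrite (eq_bigr _ (fun i _ => h'E i)) -(big_mkord xpredT h').
rewrite (eq_bigr (fun k : 'I_n => h' k.*2 * h' k.*2.+1)); last first.
  by move=> k _; rewrite !h'E.
rewrite -(big_mkord xpredT (fun k => h' k.*2 * h' k.*2.+1)).
elim: (n) => [|m IH]; first by rewrite !big_nil.
by rewrite doubleS !big_nat_recr //= IH mulrA.
Qed.

Lemma halfI_subproof n (j : 'I_n.*2) : (j./2 < n)%N.
Proof. by rewrite ltn_half_double. Qed.

Definition halfI n (j : 'I_n.*2) : 'I_n := Ordinal (halfI_subproof j).

Definition unpair n T (phi : 'I_n -> T * T) (j : 'I_n.*2) : T :=
  if odd j then (phi (halfI j)).2 else (phi (halfI j)).1.

Lemma unpair_even n T (phi : 'I_n -> T * T) k :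
  unpair phi (evenI k) = (phi k).1.
Proof.
rewrite /unpair /= odd_double; congr (phi _).1.
by apply: val_inj => /=; rewrite doubleK.
Qed.

Lemma unpair_odd n T (phi : 'I_n -> T * T) k :
  unpair phi (oddI k) = (phi k).2.
Proof.
rewrite /unpair /= odd_double; congr (phi _).2.
by apply: val_inj => /=; rewrite uphalf_double.
Qed.

(** Each entry of the product is a double sum over column indices of [V]. Distributing the product
    over [k] makes [phi] choose one pair of columns per factor, and the signed sum over permutations
    becomes a determinant. *)
Lemma Pf_congruence (F : numFieldType) n m (V : 'M[F]_(n.*2, m)) (g : 'M[F]_m) :
  Pf (V *m g *m V^T) = ((2 ^ n * n`!)%N%:R)^-1 *
    \sum_(phi : {ffun 'I_n -> ('I_m * 'I_m)%type})
      (\prod_k g (phi k).1 (phi k).2) *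
      \det (\matrix_(j, i) V i (unpair phi j)).
Proof.
rewrite /Pf; congr (_ * _).
under [RHS]eq_bigr => phi _ do rewrite /determinant mulr_sumr.
rewrite exchange_big /=; apply: eq_bigr => s _.
under [RHS]eq_bigr => phi _ do rewrite mulrCA.
rewrite -mulr_sumr; congr (_ * _).
pose G k (pq : 'I_m * 'I_m) :=
  g pq.1 pq.2 * (V (s (evenI k)) pq.1 * V (s (oddI k)) pq.2).
transitivity (\prod_(k < n) \sum_(pq : 'I_m * 'I_m) G k pq).
  apply: eq_bigr => k _; rewrite !mxE.
  rewrite -(pair_bigA _ (fun p q => G k (p, q))) exchange_big /=.
  apply: eq_bigr => q _; rewrite !mxE mulr_suml; apply: eq_bigr => p _.
  by rewrite /G /=; ring.
rewrite bigA_distr_bigA /=; apply: eq_bigr => phi _.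
rewrite big_split /=; congr (_ * _).
under [RHS]eq_bigr => i _ do rewrite mxE.
rewrite prod_double; apply: eq_bigr => k _.
by rewrite unpair_even unpair_odd.
Qed.

Lemma size_le_sorted_rcons (s : seq nat) x :
  sorted ltn (rcons s x) -> (size s <= x)%N.
Proof.
elim/last_ind: s x => // s y IH x; rewrite -cats1 => sx.
have ys : sorted ltn (rcons s y).
  by have [] := cat_sorted2 sx.
rewrite size_rcons; apply: leq_ltn_trans (IH _ ys) _.
move: sx; rewrite cats1; case: (s) => [|z s'] /=; first by rewrite andbT.
by rewrite rcons_path last_rcons => /andP[].
Qed.

(* The i-th smallest element of s is at least i. *)
Lemma prod_uniq_le (F : numDomainType) (b h : nat -> F) (s : seq nat) :
  (forall p, 0 <= b p) -> (forall p q, (p <= q)%N -> b q <= h p) ->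
  uniq s -> \prod_(p <- s) b p <= \prod_(0 <= i < size s) h i.
Proof.
move=> b0 bh us.
have -> : \prod_(p <- s) b p = \prod_(p <- sort leq s) b p.
  by apply: perm_big; rewrite perm_sym perm_sort.
rewrite -(size_sort leq s).
have : sorted ltn (sort leq s).
  by rewrite ltn_sorted_uniq_leq sort_uniq us sort_sorted //; exact: leq_total.
elim/last_ind: (sort leq s) => [|t x IH] st; first by rewrite !big_nil.
rewrite -cats1 big_cat /= size_cat addn1 big_nat_recr //= big_seq1.
apply: ler_pM => //; first by apply: prodr_ge0 => p _.
  apply: IH; move: st; rewrite -cats1; by move=> /cat_sorted2[].
by apply: bh; apply: size_le_sorted_rcons.
Qed.

Lemma det_le (F : numDomainType) m (A : 'M[F]_m) (v : 'I_m -> F) :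
  (forall j i, `|A j i| <= v j) -> `|\det A| <= m`!%:R * \prod_j v j.
Proof.
move=> Av; apply: le_trans (ler_norm_sum _ _ _) _.
have -> : m`!%:R * \prod_j v j = \sum_(s : 'S_m) \prod_j v j.
  by rewrite sumr_const card_Sn mulr_natl.
apply: ler_sum => s _.
by rewrite normrM normr_sign mul1r normr_prod; apply: ler_prod => j _; rewrite normr_ge0 Av.
Qed.

Lemma sum_half_pow_le (F : numFieldType) m :
  \sum_(p < m) 2^-1 ^+ p <= 2 :> F.
Proof.
rewrite -(big_mkord xpredT (fun p => 2^-1 ^+ p : F)).
have -> : \sum_(0 <= p < m) 2^-1 ^+ p = 2 - 2 * 2^-1 ^+ m :> F.
  elim: m => [|m IH]; first by rewrite big_nil expr0 mulr1 subrr.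
  by rewrite big_nat_recr //= IH exprS; field.
by rewrite gerBl mulr_ge0 // exprn_ge0 // invr_ge0.
Qed.

(* The determinants vanish unless [unpair phi] is injective, so each surviving
   term involves 2n distinct columns of V; this is where the decay of the
   product of h comes from. *)
Lemma Pf_congruence_le (F : numFieldType) n m (V : 'M[F]_(n.*2, m)) (g : 'M[F]_m)
    (v w b h : nat -> F) :
  (forall i p, `|V i p| <= v p) -> (forall p q, `|g p q| <= w p * w q) ->
  (forall p, 0 <= w p) -> (forall p, v p * w p <= b p * 2^-1 ^+ p) ->
  (forall p, 0 <= b p) -> (forall p q, (p <= q)%N -> b q <= h p) ->
  `|Pf (V *m g *m V^T)| <=
    (2 ^ n * n`!)%N%:R^-1 * ((n.*2)`!%:R * \prod_(0 <= i < n.*2) h i * 4 ^+ n).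
Proof.
move=> Vv gw w0 vw b0 bh.
have h0 p : 0 <= h p by exact: le_trans (b0 p) (bh p p _).
rewrite Pf_congruence normrM gtr0_norm; last first.
  by rewrite invr_gt0 ltr0n muln_gt0 expn_gt0 fact_gt0.
rewrite ler_wpM2l ?invr_ge0 //; apply: le_trans (ler_norm_sum _ _ _) _.
pose H : F := (n.*2)`!%:R * \prod_(0 <= i < n.*2) h i.
have H0 : 0 <= H by rewrite mulr_ge0 // prodr_ge0.
(* The geometric weights keep the sum over all [phi] below [4 ^+ n] whatever [m] is, so that the
   bound survives the limit in [m]. *)
pose e (pq : 'I_m * 'I_m) : F := 2^-1 ^+ pq.1 * 2^-1 ^+ pq.2.
have e0 pq : 0 <= e pq by rewrite mulr_ge0 // exprn_ge0 // invr_ge0.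
apply: (@le_trans _ _ (\sum_(phi : {ffun 'I_n -> ('I_m * 'I_m)%type})
                          H * \prod_k e (phi k))).
  apply: ler_sum => phi _.
  have [inj|] := boolP (injectiveb (fun j => val (unpair phi j))); last first.
    case/injectivePn => j1 [j2 j12 eqj].
    rewrite [X in _ * X](determinant_alternate j12); last first.
      by move=> i; rewrite !mxE (val_inj eqj).
    by rewrite mulr0 normr0 mulr_ge0 // prodr_ge0.
  have {}inj := injectiveP _ inj.
  have -> : \prod_k e (phi k) = \prod_j 2^-1 ^+ unpair phi j.
    by rewrite prod_double; apply: eq_bigr => k _; rewrite unpair_even unpair_odd.
  rewrite normrM normr_prod.
  apply: (@le_trans _ _ ((\prod_j w (unpair phi j)) *
                        ((n.*2)`!%:R * \prod_j v (unpair phi j)))).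
    apply: ler_pM => //; first exact: prodr_ge0.
      rewrite prod_double; apply: ler_prod => k _.
      by rewrite normr_ge0 unpair_even unpair_odd gw.
    by apply: det_le => j i; rewrite mxE.
  rewrite mulrCA -big_split /= /H -mulrA ler_wpM2l //.
  apply: (@le_trans _ _ (\prod_j (b (unpair phi j) * 2^-1 ^+ unpair phi j))).
    apply: ler_prod => j _; rewrite mulrC vw andbT mulr_ge0 //.
    by apply: le_trans (Vv j (unpair phi j)).
  rewrite big_split /= ler_wpM2r //.
    by rewrite prodr_ge0 // => j _; rewrite exprn_ge0 // invr_ge0.
  pose s := [seq val (unpair phi j) | j <- index_enum 'I_n.*2].
  have us : uniq s by rewrite map_inj_uniq // index_enum_uniq.
  have := prod_uniq_le b0 bh us.
  by rewrite big_map size_map /index_enum -enumT size_enum_ord.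
rewrite -mulr_sumr ler_wpM2l // -(bigA_distr_bigA (fun _ : 'I_n => e)).
rewrite prodr_const card_ord.
pose S : F := \sum_(p < m) 2^-1 ^+ p.
have S0 : 0 <= S by apply: sumr_ge0 => p _; rewrite exprn_ge0 // invr_ge0.
have -> : \sum_(pq : 'I_m * 'I_m) e pq = S ^+ 2.
  rewrite expr2 mulr_suml -(pair_bigA _ (fun p q => e (p, q))) /=.
  by apply: eq_bigr => p _; rewrite mulr_sumr.
have S4 : S ^+ 2 <= 4.
  rewrite [X in _ <= X](_ : 4 = 2 ^+ 2); last by rewrite -natrX.
  by rewrite ler_pXn2r ?nnegrE // sum_half_pow_le.
by rewrite lerXn2r ?nnegrE // exprn_ge0.
Qed.

(** * Estimates on powers and factorials *)

Lemma expr_fact_le (R : realType) (x : R) n :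
  0 <= x -> x ^+ n / n`!%:R <= expR x.
Proof.
move=> x0; case: n => [|n].
  by rewrite expr0 fact0 divr1 -[leLHS](expR0 R) ler_expR.
by apply: le_trans (expR_ge1Dxn n x0); rewrite lerDr.
Qed.

(** Since p! (q-p)! <= q!, the quotient of the two terms is at most x^(q-p) / (q-p)!, hence at most
    e^x. This supplies the majorant [h] of [Pf_congruence_le]. *)
Lemma expr_fact_shift_le (R : realType) (x : R) p q :
  0 <= x -> (p <= q)%N ->
  x ^+ q / q`!%:R <= expR x * (x ^+ p / p`!%:R).
Proof.
move=> x0 pq.
have -> : x ^+ q = x ^+ (q - p) * x ^+ p by rewrite -exprD subnK.
apply: (@le_trans _ _ (x ^+ (q - p) / (q - p)`!%:R * (x ^+ p / p`!%:R))).
  rewrite mulrACA -invfM ler_wpM2l ?mulr_ge0 ?exprn_ge0 //.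
  rewrite lef_pV2 ?posrE ?ltr0n ?fact_gt0 -?natrM ?ltr0n ?muln_gt0 ?fact_gt0 //.
  idtac.
  by rewrite ler_nat -(bin_fact pq) [(p`! * _)%N]mulnC leq_pmull // bin_gt0.
by rewrite ler_wpM2r ?expr_fact_le // divr_ge0 ?exprn_ge0.
Qed.

Lemma succ_le_exp2 n : (n.+1 <= 2 ^ n)%N.
Proof. by elim: n => // n IH; rewrite expnS; lia. Qed.

Lemma fact_add_le m k : ((m + k)`! <= m`! * (m + k) ^ k)%N.
Proof.
elim: k => [|k IH]; first by rewrite addn0 expn0 muln1.
rewrite addnS factS expnS mulnCA leq_mul2l /=.
by apply: leq_trans IH _; rewrite leq_mul2l; case: (k) => [|j]; rewrite ?leqnn ?orbT // leq_exp2r // leqnSn orbT.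
Qed.

(** From n to n+1, the left side grows by a factor of at most (n+1)^(2(2n+1)) and the product by
    (2n)! (2n+1)!; the bound (n+1)^m <= e^(n+1) m! compares the two. *)
Lemma fact_sqr_le (R : realType) : exists2 C : R, 1 <= C & forall n : nat,
  (n ^ 2)`!%:R <= C ^+ (n ^ 2) * \prod_(0 <= i < n.*2) i`!%:R.
Proof.
exists (2 * expR 2); first by rewrite -[leLHS]mulr1 ler_pM // ?ler1n // -[leLHS](expR0 R) ler_expR.
elim=> [|n IH]; first by rewrite big_nil mulr1.
have e1 : 1 <= expR 1 :> R by rewrite -[leLHS](expR0 R) ler_expR.
have pw m : n.+1%:R ^+ m <= expR n.+1%:R * m`!%:R :> R.
  by rewrite -ler_pdivrMr ?ltr0n ?fact_gt0 // expr_fact_le.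
have fD : ((n.+1 ^ 2)`! <= (n ^ 2)`! * (n.+1 ^ 2) ^ n.*2.+1)%N.
  have e : (n.+1 ^ 2 = n ^ 2 + n.*2.+1)%N by rewrite -muln2; lia.
  by rewrite [in X in (X <= _)%N]e [in X in (_ <= X)%N]e fact_add_le.
rewrite doubleS !big_nat_recr //=.
set Q := \prod_(0 <= i < _) _ in IH *.
have Q0 : 0 <= Q by rewrite /Q prodr_ge0.
apply: (@le_trans _ _ ((n ^ 2)`!%:R * (n.+1%:R ^+ 2) ^+ n.*2.+1)).
  by rewrite -!natrX -natrM ler_nat.
have -> : ((2 * expR 2) ^+ (n.+1 ^ 2) : R) =
          (2 * expR 2) ^+ (n ^ 2) * (2 * expR 2) ^+ n.*2.+1.
  by rewrite -exprD; congr (_ ^+ _); rewrite -muln2; lia.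
rewrite [leRHS](_ : _ = ((2 * expR 2) ^+ (n ^ 2) * Q) *
   ((2 * expR 2) ^+ n.*2.+1 * (n.*2`!%:R * n.*2.+1`!%:R))); last by ring.
apply: ler_pM => //.
rewrite -exprM.
(* The power (n+1)^(2n+1) is charged to (2n+1)!, the power (n+1)^(2n) to (2n)!, and the remaining
   factor n+1 is at most 2^n. *)
have -> : (2 * n.*2.+1 = n.*2.+1 + n.*2 + 1)%N by lia.
rewrite !exprD expr1.
apply: (@le_trans _ _ ((expR n.+1%:R * n.*2.+1`!%:R) * (expR n.+1%:R * n.*2`!%:R) * 2 ^+ n)).
  apply: ler_pM; rewrite ?mulr_ge0 ?exprn_ge0 //.
    by apply: ler_pM; rewrite ?exprn_ge0.
  by rewrite -natrX ler_nat succ_le_exp2.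
rewrite [leLHS](_ : _ = (2 ^+ n * (expR n.+1%:R * expR n.+1%:R)) *
   (n.*2`!%:R * n.*2.+1`!%:R)); last by ring.
rewrite ler_wpM2r // exprMn.
apply: ler_pM; rewrite ?mulr_ge0 ?exprn_ge0 ?expR_ge0 //.
  by rewrite ler_weXn2l // ?ler1n //; lia.
rewrite -expRD -expRM_natr ler_expR -natrD -natrM ler_nat; lia.
Qed.

(** * Taylor series of IS and S *)

Section ISseries.
Variable R : realType.
Implicit Types (t : R) (c : nat -> R).

(* Normalised Taylor coefficients: the series of c is sum_k c_k t^k / k!, so that
   differentiation becomes the tshift of c. *)
Definition tser c t : R := limn (pseries (fun k => c k / k`!%:R) t).

Definition tshift c (k : nat) : R := c k.+1.

(** With exponent [k] the coefficient of index 0 would be at most 1 in absolute value; the exponent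
    [k.+1] makes the class stable under [tshift]. *)
Definition geo_bounded c := exists2 B : R, 0 <= B & forall k, `|c k| <= B ^+ k.+1.

Lemma geo_bounded_tshift c : geo_bounded c -> geo_bounded (tshift c).
Proof.
move=> [B B0 cB]; exists ((1 + B) ^+ 2); first by rewrite exprn_ge0 // addr_ge0.
move=> k; apply: le_trans (cB k.+1) _; rewrite -exprM.
apply: (@le_trans _ _ ((1 + B) ^+ k.+2)).
  by rewrite lerXn2r ?nnegrE ?addr_ge0 // lerDr.
by rewrite ler_weXn2l ?lerDl //; lia.
Qed.

Lemma is_cvg_tser c t : geo_bounded c -> cvgn (pseries (fun k => c k / k`!%:R) t).
Proof.
move=> [B B0 cB]; apply: normed_cvg; rewrite /normed_series_of /=.
apply: (@series_le_cvg _ _ (fun n => B * exp_coeff (B * `|t|) n)) => [n|n|n|].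
- exact: normr_ge0.
- by rewrite /exp_coeff /= mulr_ge0 // divr_ge0 // exprn_ge0 // mulr_ge0.
- rewrite /exp_coeff /= !normrM normrX normfV normr_nat.
  rewrite exprMn [leLHS](_ : _ = `|c n| * (`|t| ^+ n / n`!%:R)); last by ring.
  rewrite [leRHS](_ : _ = B ^+ n.+1 * (`|t| ^+ n / n`!%:R)); last by rewrite exprS; ring.
  by rewrite ler_wpM2r // mulr_ge0 // exprn_ge0.
- have -> : (fun n => B * exp_coeff (B * `|t|) n) = B *: exp_coeff (B * `|t|) by [].
  by apply: is_cvg_seriesZ; exact: is_cvg_series_exp_coeff.
Qed.

Lemma cvg_tser c t : geo_bounded c ->
  \sum_(0 <= k < m) (c k / k`!%:R * t ^+ k) @[m --> \oo] --> tser c t.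
Proof. by move=> /is_cvg_tser; exact. Qed.

Lemma pseries_diffs_tser c :
  pseries_diffs (fun k => c k / k`!%:R) = (fun k => tshift c k / k`!%:R).
Proof.
apply/funext => k; rewrite /pseries_diffs /tshift factS natrM invfM.
by rewrite mulrCA mulVKf.
Qed.

Lemma is_derive_tser c t : geo_bounded c ->
  is_derive t (1 : R) (tser c) (tser (tshift c) t).
Proof.
move=> cB; have sB := geo_bounded_tshift cB; have ssB := geo_bounded_tshift sB.
rewrite /tser -[X in limn (pseries X t)]pseries_diffs_tser.
(* Termwise differentiation at [t] asks for convergence of the series and of its first two formal
   derivatives at a point of larger modulus, here |t| + 1. *)
apply: (@pseries_snd_diffs _ _ (`|t| + 1)); rewrite ?pseries_diffs_tser.
- exact: is_cvg_tser.
- exact: is_cvg_tser.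
- exact: is_cvg_tser.
- by rewrite [ltRHS]ger0_norm ?addr_ge0 // ltrDl.
Qed.

(** The derivatives of IS at 0: since S(t) = sum_j (-1)^j (pi t)^(2j) / (2j+1)!, the one of order k
    = 2j+1 is (-1)^j pi^(2j) / (2j+1), and those of even order vanish. *)
Definition ISc (k : nat) : R := (odd k)%:R * (-1) ^+ k./2 * pi ^+ k.-1 / k%:R.

Lemma ISc_le k : `|ISc k| <= 4 ^+ k.
Proof.
rewrite /ISc; case: k => [|k]; first by rewrite mul0r !mul0r normr0 expr0.
have pi4 : pi <= 4 :> R.
  by have := @pihalf_lt2 R; rewrite ltr_pdivrMr // => /ltW; rewrite -natrM.
rewrite !normrM normfV normrX normrN1 expr1n mulr1 !normrX /=.
rewrite (ger0_norm (pi_ge0 R)) normr_nat.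
have pk0 : 0 <= pi ^+ k :> R by rewrite exprn_ge0 ?pi_ge0.
apply: (@le_trans _ _ (1 * pi ^+ k / 1)).
  apply: ler_pM => //; first by rewrite mulr_ge0.
    by rewrite ler_wpM2r //; case: (~~ _).
  by rewrite normr_nat invr1 invf_le1 ?ler1n ?ltr0n.
rewrite divr1 mul1r; apply: (@le_trans _ _ (4 ^+ k)).
  by rewrite lerXn2r ?nnegrE ?pi_ge0.
by rewrite ler_weXn2l // ler1n.
Qed.

Lemma geo_bounded_ISc : geo_bounded ISc.
Proof.
exists 4 => // k; apply: le_trans (ISc_le k) _.
by rewrite ler_weXn2l // ler1n.
Qed.

Lemma tser0 c : geo_bounded c -> tser c 0 = c 0%N.
Proof.
move=> cB; apply: cvg_lim => //; rewrite -(cvg_shiftS _) /=.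
apply: cvg_near_cst; near=> m.
rewrite /pseries /series /= big_nat_recl //= big1 ?addr0 ?fact0 ?divr1 ?mulr1 //.
by move=> i _; rewrite expr0n /= mulr0.
Unshelve. all: by end_near.
Qed.

Lemma Sfun_tser t : Sfun t = tser (tshift ISc) t.
Proof.
have B := geo_bounded_tshift geo_bounded_ISc.
rewrite /Sfun; have [->|t0] := eqVneq t 0.
  by rewrite tser0 // /tshift /ISc /= !mul1r invr1.
have pt0 : pi * t != 0 :> R by rewrite mulf_neq0 // gt_eqF // pi_gt0.
apply/eqP; rewrite eq_sym; apply/eqP.
apply: cvg_lim => //.
(* The sine series has no constant term, so [m] terms here match [m.+1] terms there. *)
suff -> : pseries (fun k => tshift ISc k / k`!%:R) t =
          (fun m => series (sin_coeff (pi * t)) m.+1 / (pi * t)).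
  apply: cvgMl; rewrite (cvg_shiftS (series (sin_coeff (pi * t)))).
  by rewrite sin.unlock; exact: is_cvg_series_sin_coeff.
apply/funext => m; rewrite /pseries /series /= big_nat_recl //=.
rewrite {1}/sin_coeff /= !mul0r add0r mulr_suml; apply: eq_bigr => k _.
rewrite /tshift /ISc /sin_coeff /= !exprMn exprS [(t ^+ k.+1)]exprS factS natrM.
have k0 : k.+1%:R != 0 :> R by [].
have f0 : k`!%:R != 0 :> R by rewrite pnatr_eq0 -lt0n fact_gt0.
have p0 : pi != 0 :> R by rewrite gt_eqF // pi_gt0.
case: (boolP (odd k)) => ok /=; first by rewrite !mul0r.
rewrite uphalf_half (negbTE ok) add0n.
move: (@pi R) p0 => p p0; field.
by rewrite t0 p0 f0 nat1r k0.
Qed.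

End ISseries.
Arguments tshift {R}.

(** * The kernel entries as power series, and the binomial convolution *)

Section Kernel_series.
Variable R : realType.
Implicit Types (t x y : R) (c : nat -> R).

Lemma continuous_tser c : geo_bounded c -> continuous (tser c).
Proof.
move=> cB t; apply: differentiable_continuous; apply/derivable1_diffP.
by have [] := is_derive_tser t cB.
Qed.

Lemma integral_Sfun (a b : R) : a <= b ->
  \int[lebesgue_measure]_(u in `[a, b]) Sfun u =
  tser (@ISc R) b - tser (@ISc R) a.
Proof.
have B := @geo_bounded_ISc R; have sB := geo_bounded_tshift B.
have SE : @Sfun R = tser (tshift (@ISc R)) by apply/funext => t; exact: Sfun_tser.
rewrite le_eqVlt => /orP[/eqP <-|ab].
  by rewrite set_itv1 /Rintegral integral_set1 subrr.
rewrite /Rintegral (@continuous_FTC2 _ _ (tser (@ISc R)) _ _ ab) //.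
- by apply: continuous_subspaceT; rewrite SE; exact: continuous_tser.
- split.
  + by move=> u _; have [] := is_derive_tser u B.
  + by apply: cvg_at_right_filter; exact: continuous_tser.
  + by apply: cvg_at_left_filter; exact: continuous_tser.
- move=> u _; rewrite derive1E SE; exact: (@derive_val _ _ _ _ _ _ _ (is_derive_tser u B)).
Qed.

Lemma ISfun_tser t : ISfun t = tser (@ISc R) t.
Proof.
have T0 : tser (@ISc R) 0 = 0.
  by rewrite tser0 ?/ISc ?mul0r //; exact: geo_bounded_ISc.
rewrite /ISfun; case: (leP 0 t) => [t0|/ltW t0]; rewrite integral_Sfun // T0.
  by rewrite subr0.
by rewrite sub0r opprK.
Qed.

Lemma DSfun_tser t : DSfun t = tser (tshift (tshift (@ISc R))) t.
Proof.
have sB := geo_bounded_tshift (@geo_bounded_ISc R).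
rewrite /DSfun (_ : @Sfun R = tser (tshift (@ISc R))); last first.
  by apply/funext => u; exact: Sfun_tser.
rewrite derive1E; exact: (@derive_val _ _ _ _ _ _ _ (is_derive_tser t sB)).
Qed.


(* The a-th derivative of t^k / k!. *)
Definition dpow (a k : nat) t : R :=
  if (a <= k)%N then t ^+ (k - a) / (k - a)`!%:R else 0.

(** This is the binomial expansion of (x-y)^k / k! differentiated [a] times in x and [b] times in y,
    whence the sign. In the induction, each derivative kills an end term of the sum and shifts the
    index. *)
Lemma dpow_convolution a b k x y :
  \sum_(p < k.+1) dpow a p x * ((-1) ^+ (k - p) * dpow b (k - p) y) =
  (-1) ^+ b * dpow (a + b) k (x - y).
Proof.
elim: a k => [|a IHa] k; last first.
  case: k => [|k]; first by rewrite big_ord1 {1}/dpow mul0r /dpow mulr0.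
  rewrite big_ord_recl {1}/dpow mul0r add0r -[dpow _ _ (x - y)]/(dpow (a + b) k (x - y)) -IHa.
  by apply: eq_bigr.
elim: b k => [|b IHb] k.
  rewrite expr0 mul1r /dpow !subn0 exprBn mulr_suml.
  rewrite (reindex_inj rev_ord_inj) /=.
  apply: eq_bigr => p _; have pk : (p <= k)%N by rewrite -ltnS.
  rewrite !subn0 subSS subKn // -[in RHS]mulr_natr.
  have f m : m`!%:R != 0 :> R by rewrite pnatr_eq0 -lt0n fact_gt0.
  have /(congr1 (fun m => m%:R : R)) := bin_fact pk.
  rewrite !natrM => <-; field.
  by rewrite !f pnatr_eq0 -lt0n bin_gt0.
case: k => [|k]; first by rewrite big_ord1 /dpow /= !mulr0.
rewrite big_ord_recr /= subnn {2}/dpow !mulr0 addr0.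
rewrite exprS mulN1r mulNr -[dpow _ _ (x - y)]/(dpow (0 + b) k (x - y)) -IHb -sumrN.
apply: eq_bigr => p _; have pk : (p <= k)%N by rewrite -ltnS.
by rewrite subSn // exprS mulN1r mulNr mulrN.
Qed.

(** The first [j] monomials are killed by [j] derivatives, hence the longer range on the left. *)
Lemma sum_dpow j m c t :
  \sum_(0 <= k < m + j) c k * dpow j k t =
  \sum_(0 <= k < m) iter j tshift c k / k`!%:R * t ^+ k.
Proof.
elim: j c => [|j IHj] c.
  rewrite addn0; apply: eq_bigr => k _.
  by rewrite /dpow /= subn0 mulrA mulrAC.
rewrite addnS big_nat_recl // {1}/dpow /= mulr0 add0r -iterS iterSr -IHj.
by apply: eq_bigr.
Qed.

Lemma cvg_sum_dpow j c t : geo_bounded c ->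
  \sum_(0 <= k < m) c k * dpow j k t @[m --> \oo] --> tser (iter j tshift c) t.
Proof.
move=> cB; rewrite -(cvg_shiftn j) /=.
under eq_fun do rewrite sum_dpow.
apply: cvg_tser; elim: j => // j IHj; exact: geo_bounded_tshift.
Qed.

(** All four entries are derivatives of one function: entry (a, b) is -IS(x-y)/2 differentiated [a]
    times in x and [b] times in y. *)
Lemma K4_tser x y (a b : bool) :
  K4 x y (inord a) (inord b) =
  (-1) ^+ b * (- 2^-1) * tser (iter (a + b) tshift (@ISc R)) (x - y).
Proof.
have i0 : inord false = lshift 1 (ord0 : 'I_1) by apply: val_inj; rewrite /= inordK.
have i1 : inord true = rshift 1 (ord0 : 'I_1) by apply: val_inj; rewrite /= inordK.
rewrite /K4 mxE; case: a; case: b; rewrite ?i0 ?i1.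
- by rewrite block_mxEdr mxE /= mulr1n DSfun_tser expr1; ring.
- by rewrite block_mxEdl mxE /= mulr1n Sfun_tser expr0; ring.
- by rewrite block_mxEur mxE /= mulr1n Sfun_tser expr1; ring.
- by rewrite block_mxEul mxE /= mulr1n ISfun_tser expr0; ring.
Qed.

End Kernel_series.

(** * Bound on the Pfaffian of the kernel *)

Section Pf_K4_bound.
Variable R : realType.

Lemma sum_triangle (F : nat -> nat -> R) m :
  \sum_(q < m) \sum_(p < m) (if (p + q < m)%N then F p q else 0) =
  \sum_(k < m) \sum_(p < k.+1) F p (k - p)%N.
Proof.
rewrite exchange_big /=.
transitivity (\sum_(p < m) \sum_(k < m) if (p <= k)%N then F p (k - p)%N else 0).
  apply: eq_bigr => p _; rewrite -!big_mkcond /=.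
  have pm := ltnW (ltn_ord p).
  rewrite -(big_mkord (fun q => p + q < m)%N (fun q => F p q)).
  rewrite -(big_mkord (fun k => p <= k)%N (fun k => F p (k - p)%N)).
  rewrite [RHS](big_cat_nat (leq0n p) pm) /= [X in _ = X + _]big1_seq ?add0r; last first.
    by move=> k /andP[pk]; rewrite mem_index_iota => /andP[_]; rewrite ltnNge pk.
  rewrite (big_cat_nat (leq0n (m - p)) (leq_subr p m)) /= [X in _ + X]big1_seq ?addr0; last first.
    by move=> q /andP[pq]; rewrite mem_index_iota; lia.
  have := big_addn 0 m p (fun k => p <= k)%N (fun k => F p (k - p)%N).
  rewrite add0n => ->; rewrite big_nat_cond [RHS]big_nat_cond.
  by apply: eq_big => [q|q _]; [lia | rewrite addnK].
rewrite exchange_big /=; apply: eq_bigr => k _; rewrite -big_mkcond /=.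
rewrite (big_ord_widen m (fun p => F p (k - p)%N)) //.
Qed.

Definition K4_left n m (x0 : R) (x : n.-tuple R) : 'M[R]_(n.*2, m) :=
  \matrix_(i, p) dpow (odd i) p (x`_i./2 - x0).

(** Cutting along p + q < m, rather than keeping the full square, turns V g V^T into exact Taylor
    polynomials in x-y. The sign (-1)^q comes from expanding (x-y)^(p+q). *)
Definition K4_core m : 'M[R]_m :=
  \matrix_(p, q) if (p + q < m)%N then - 2^-1 * ISc R (p + q) * (-1) ^+ q else 0.

Lemma K4_approxE n m x0 (x : n.-tuple R) i j :
  (K4_left m x0 x *m K4_core m *m (K4_left m x0 x)^T) i j =
  (-1) ^+ odd j * (- 2^-1) *
  \sum_(0 <= k < m) ISc R k * dpow (odd i + odd j) k (x`_i./2 - x`_j./2).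
Proof.
rewrite mxE.
pose F p q := dpow (odd i) p (x`_i./2 - x0) * (- 2^-1 * ISc R (p + q) * (-1) ^+ q)
   * dpow (odd j) q (x`_j./2 - x0).
transitivity (\sum_(q < m) \sum_(p < m) (if (p + q < m)%N then F p q else 0)).
  apply: eq_bigr => q _; rewrite !mxE mulr_suml; apply: eq_bigr => p _.
  by rewrite !mxE; case: ifP => // _; rewrite mulr0 mul0r.
rewrite sum_triangle big_mkord mulr_sumr; apply: eq_bigr => k _.
(* The kernel sees only differences, so recentring at [x0] is free. *)
have -> : x`_i./2 - x`_j./2 = (x`_i./2 - x0) - (x`_j./2 - x0) by ring.
rewrite [RHS](_ : _ = (- 2^-1 * ISc R k) * ((-1) ^+ odd j * dpow (odd i + odd j) k
   ((x`_i./2 - x0) - (x`_j./2 - x0)))); last by ring.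
rewrite -dpow_convolution mulr_sumr; apply: eq_bigr => p _.
rewrite /F subnKC; last by rewrite -ltnS.
by ring.
Qed.

Lemma K4_approx_cvg n x0 (x : n.-tuple R) i j :
  (K4_left m x0 x *m K4_core m *m (K4_left m x0 x)^T) i j @[m --> \oo]
    --> K4_mx x i j.
Proof.
under eq_fun do rewrite K4_approxE.
rewrite /K4_mx mxE K4_tser; apply: cvgMr.
exact/cvg_sum_dpow/geo_bounded_ISc.
Qed.

Lemma Pf_cvg n (A : nat -> 'M[R]_n.*2) (B : 'M[R]_n.*2) :
  (forall i j, A m i j @[m --> \oo] --> B i j) ->
  Pf (A m) @[m --> \oo] --> Pf B.
Proof.
move=> AB; rewrite /Pf; apply: cvgMr.
apply: cvg_big => [|s _]; first exact: add_continuous.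
apply: cvgMr.
by apply: cvg_big => [|k _]; [exact: mul_continuous | exact: AB].
Qed.

(** The factor 2^p pays for the derivative: 1/(p-1)! = p/p! and p <= 2^p. *)
Lemma dpow_le (a : bool) p (t : R) :
  `|t| <= 1 -> `|dpow a p t| <= 2 ^+ p / p`!%:R.
Proof.
move=> t1; rewrite /dpow; case: ifP => ap; last first.
  by rewrite normr0 divr_ge0 // exprn_ge0.
rewrite normrM normfV normr_nat normrX.
apply: (@le_trans _ _ (1 / (p - a)`!%:R)).
  by rewrite ler_wpM2r ?invr_ge0 // exprn_ile1.
rewrite mul1r ler_pdivlMr ?ltr0n ?fact_gt0 // ler_pdivrMl ?ltr0n ?fact_gt0 //.
rewrite -natrX -natrM ler_nat.
case: a ap => [|_]; last by rewrite subn0 leq_pmulr // expn_gt0.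
by case: p => // p _; rewrite subn1 factS mulnC leq_mul2l (leq_trans (succ_le_exp2 p)) ?orbT // leq_exp2l.
Qed.

Lemma Pf_K4_le_prod n x0 (x : n.-tuple R) :
  (forall y, y \in x -> `|y - x0| <= 1) ->
  `|Pf (K4_mx x)| <= (2 ^ n * n`!)%N%:R^-1 * ((n.*2)`!%:R *
     \prod_(0 <= i < n.*2) (expR 16 * (16 ^+ i / i`!%:R)) * 4 ^+ n).
Proof.
move=> xx0; set D := leRHS.
have /cvg_norm cP := Pf_cvg (@K4_approx_cvg n x0 x).
rewrite -(cvg_lim _ cP) //.
apply: limr_le; first by apply/cvg_ex; exists `|Pf (K4_mx x)|.
near=> m.
have b0 p : 0 <= 16 ^+ p / p`!%:R :> R by rewrite divr_ge0 // exprn_ge0.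
(* The product of the bounds on [V] and on the core is 8^p / p!; writing 8 = 16/2 splits off the
   geometric weight. *)
apply: (@Pf_congruence_le _ _ _ _ _ (fun p => 2 ^+ p / p`!%:R) (fun p => 4 ^+ p)
  (fun p => 16 ^+ p / p`!%:R)) => //.
- move=> i p; rewrite mxE; apply: dpow_le; apply: xx0.
  by rewrite mem_nth // size_tuple ltn_half_double.
- move=> p q; rewrite mxE; case: ifP => _; last first.
    by rewrite normr0 mulr_ge0 // exprn_ge0.
  have := ISc_le R (p + q); move: (ISc R (p + q)) => s; rewrite exprD => sle.
  rewrite !normrM normrN normfV normr_nat normrX normrN1 expr1n mulr1.
  by apply: le_trans sle; rewrite ler_piMl // invf_le1 // ler1n.
- move=> p; rewrite [leLHS](_ : _ = (2 * 4) ^+ p / p`!%:R); last by rewrite exprMn; ring.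
  rewrite [leRHS](_ : _ = (16 * 2^-1) ^+ p / p`!%:R); last by rewrite exprMn; ring.
  by rewrite (_ : 16 * 2^-1 = 2 * 4 :> R) //; field.
- by move=> p q pq; exact: expr_fact_shift_le.
Unshelve. all: by end_near.
Qed.

(** The factorials in the denominator combine into (n^2)! by [fact_sqr_le]; all other growth is at
    most exponential in n^2 and goes into [D]. *)
Lemma Pf_K4_le : exists2 D : R, 1 <= D & forall n x0 (x : n.-tuple R),
  (forall y, y \in x -> `|y - x0| <= 1) ->
  `|Pf (K4_mx x)| <= D ^+ (n ^ 2) / (n ^ 2)`!%:R.
Proof.
have [C C1 HC] := fact_sqr_le R.
set e : R := expR 16.
have e1 : 1 <= e by rewrite /e -[leLHS](expR0 R) ler_expR.
have eg1 : 1 <= e ^+ 2 * 256 by rewrite -[leLHS]mulr1 ler_pM ?exprn_ege1 ?ler1n.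
(* The 16 comes from (2n)! <= (2^(2n))^(2n), [C] from [fact_sqr_le], e^2 * 256 from the 2n factors e
   * 16^i (the exponents i add up to at most 2n^2), and 4 from 4^n. *)
exists (16 * (C * (e ^+ 2 * 256)) * 4).
  rewrite -[leLHS]mulr1 ler_pM ?ler1n // -[leLHS]mulr1 ler_pM ?ler1n //.
  by rewrite -[leLHS]mulr1 ler_pM.
move=> n x0 x /Pf_K4_le_prod /le_trans; apply.
set Q := \prod_(0 <= i < n.*2) i`!%:R : R.
have Q0 : 0 < Q by rewrite prodr_gt0 // => i _; rewrite ltr0n fact_gt0.
have nn : (n <= n ^ 2)%N by case: (n) => // k; rewrite -mulnn leq_pmulr.
have L1 : (n.*2)`!%:R <= 16 ^+ (n ^ 2) :> R.
  rewrite -natrX ler_nat; apply: leq_trans (fact_add_le 0 n.*2) _.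
  rewrite fact0 mul1n add0n.
  have h2 : (n.*2 <= 2 ^ n.*2)%N by apply: leq_trans (leqnSn _) (succ_le_exp2 _).
  case: (posnP n) => [->//|n0].
  apply: leq_trans (_ : ((2 ^ n.*2) ^ n.*2 <= _)%N); first by rewrite leq_exp2r // double_gt0.
  by rewrite -expnM (_ : 16 = 2 ^ 4)%N // -expnM leq_exp2l // -muln2; lia.
have L2 : \prod_(0 <= i < n.*2) (e * (16 ^+ i / i`!%:R)) <= (e ^+ 2 * 256) ^+ (n ^ 2) / Q.
  rewrite ler_pdivlMr // /Q -big_split /=.
  under eq_bigr => i _ do rewrite -mulrA divfK ?pnatr_eq0 -?lt0n ?fact_gt0 //.
  elim: (n) => [|k IH]; first by rewrite big_nil.
  have -> : (k.+1 ^ 2 = k ^ 2 + k.*2.+1)%N by rewrite -muln2; lia.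
  rewrite doubleS !big_nat_recr //= exprD -mulrA ler_pM //.
    by apply: prodr_ge0 => i _; rewrite mulr_ge0 ?exprn_ge0 // expR_ge0.
    by rewrite !mulr_ge0 ?exprn_ge0 // expR_ge0.
  rewrite mulrACA -exprD -expr2 exprMn ler_pM ?exprn_ge0 ?expR_ge0 //.
    by rewrite ler_eXnr // exprn_ege1.
  rewrite (_ : 256 = 16 ^+ 2); last by rewrite -natrX.
  by rewrite -exprM ler_weXn2l ?ler1n //; lia.
have L3 : Q^-1 <= C ^+ (n ^ 2) / (n ^ 2)`!%:R.
  rewrite ler_pdivlMr ?ltr0n ?fact_gt0 // ler_pdivrMl // mulrC; exact: HC.
have C0 : 0 <= C by exact: le_trans C1.
rewrite !exprMn.
apply: (@le_trans _ _ (1 * (16 ^+ (n ^ 2) *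
   ((e ^+ 2 * 256) ^+ (n ^ 2) * (C ^+ (n ^ 2) / (n ^ 2)`!%:R)) * 4 ^+ (n ^ 2)))).
  have P0 : 0 <= \prod_(0 <= i < n.*2) (e * (16 ^+ i / i`!%:R)).
    by apply: prodr_ge0 => i _; rewrite mulr_ge0 ?divr_ge0 ?exprn_ge0 // expR_ge0.
  apply: ler_pM; rewrite ?invr_ge0 ?mulr_ge0 ?exprn_ge0 //.
    by rewrite invf_le1 ?ltr0n ?ler1n ?muln_gt0 ?expn_gt0 ?fact_gt0.
  apply: ler_pM; rewrite ?mulr_ge0 ?exprn_ge0 //; last by rewrite ler_weXn2l ?ler1n.
  apply: ler_pM => //; apply: le_trans L2 _.
  by rewrite ler_wpM2l // exprn_ge0 // (le_trans _ eg1).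
by rewrite !exprMn le_eqVlt; apply/orP; left; apply/eqP; ring.
Qed.

End Pf_K4_bound.

(** * Summation over squares against the exponential series *)

Lemma bernoulli_le (R : numDomainType) (z : R) n :
  1 <= z -> 1 + n%:R * (z - 1) <= z ^+ n.
Proof.
move=> z1; have z0 : 0 <= z - 1 by rewrite subr_ge0.
elim: n => [|n IH]; first by rewrite mul0r addr0.
rewrite exprS; apply: le_trans (ler_wpM2l (le_trans ler01 z1) IH).
rewrite -subr_ge0 [leRHS](_ : _ = n%:R * (z - 1) ^+ 2); first by rewrite mulr_ge0 ?exprn_ge0.
by rewrite -natr1; ring.
Qed.

(** The block of indices from m^2 to (m+1)^2 - 1 contributes at least its first term. *)
Lemma sum_sqr_le (R : numDomainType) (u : nat -> R) m : (forall j, 0 <= u j) ->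
  \sum_(0 <= k < m) u (k ^ 2)%N <= \sum_(0 <= j < m ^ 2) u j.
Proof.
move=> u0; elim: m => [|m IH]; first by rewrite !big_nil.
have mm : (m ^ 2 < m.+1 ^ 2)%N by rewrite ltn_exp2r.
rewrite big_nat_recr //= (big_cat_nat (leq0n (m ^ 2)) (ltnW mm)) /=.
apply: lerD => //; rewrite big_ltn //= lerDl; exact: sumr_ge0.
Qed.

Lemma exp_series_le (R : realType) (D y : R) m : 0 <= D -> 1 <= y ->
  \sum_(0 <= j < m) (y ^+ j - 1) * (D ^+ j / j`!%:R) <= expR (D * y) - expR D.
Proof.
move=> D0 y1.
have -> : (fun m => \sum_(0 <= j < m) (y ^+ j - 1) * (D ^+ j / j`!%:R)) m =
          (series (exp_coeff (D * y)) - series (exp_coeff D)) m.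
  rewrite !fctE /series /= -sumrB; apply: eq_bigr => j _.
  by rewrite /exp_coeff /= exprMn; ring.
have c : (series (exp_coeff (D * y)) - series (exp_coeff D)) @ \oo --> expR (D * y) - expR D.
  apply: cvgB; exact: is_cvg_series_exp_coeff.
rewrite -(cvg_lim _ c) //; apply: nondecreasing_cvgn_le; last by apply/cvg_ex; eexists; exact: c.
apply/nondecreasing_seqP => n; rewrite -subr_ge0 !fctE /series /= !big_nat_recr //=.
rewrite [leRHS](_ : _ = (y ^+ n - 1) * (D ^+ n / n`!%:R)).
  by rewrite mulr_ge0 ?subr_ge0 ?exprn_ege1 ?divr_ge0 ?exprn_ge0.
by rewrite /exp_coeff /= exprMn; ring.
Qed.

(* Write y^(k^2) = 1 + (y^(k^2) - 1), so that the total mass is used for the first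
   summand and the bound on p for the second; Bernoulli's inequality then absorbs
   the factor e^D into the exponent. *)
Lemma sum_sqr_exp_le (R : realType) (D y : R) (p : nat -> R) m :
  0 <= D -> 1 <= y -> (forall k, p k <= D ^+ (k ^ 2) / (k ^ 2)`!%:R) ->
  \sum_(0 <= k < m) p k <= 1 ->
  \sum_(0 <= k < m) y ^+ (k ^ 2) * p k <=
    expR ((Num.trunc (expR D)).+1%:R * D * (y - 1)).
Proof.
move=> D0 y1 pD p1.
have y0 : 0 <= y - 1 by rewrite subr_ge0.
(* Bernoulli's inequality is used with a natural exponent, so e^D is replaced by a larger
   integer. *)
set K : R := (Num.trunc _).+1%:R.
have DK : expR D <= K by exact/ltW/truncnS_gt.
set z := expR (D * (y - 1)).
have z1 : 1 <= z by rewrite /z -[leLHS](expR0 R) ler_expR mulr_ge0.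
have -> : expR (K * D * (y - 1)) = z ^+ (Num.trunc (expR D)).+1.
  by rewrite /z -expRM_natl mulrA.
apply: le_trans (bernoulli_le _ z1).
have -> : \sum_(0 <= k < m) y ^+ (k ^ 2) * p k =
  \sum_(0 <= k < m) p k + \sum_(0 <= k < m) (y ^+ (k ^ 2) - 1) * p k.
  by rewrite -big_split /=; apply: eq_bigr => k _; ring.
apply: lerD => //.
pose u j : R := (y ^+ j - 1) * (D ^+ j / j`!%:R).
have u0 j : 0 <= u j.
  by rewrite /u mulr_ge0 ?subr_ge0 ?exprn_ege1 ?divr_ge0 ?exprn_ge0.
apply: (@le_trans _ _ (\sum_(0 <= k < m) u (k ^ 2)%N)).
  by apply: ler_sum => k _; rewrite ler_wpM2l // subr_ge0 exprn_ege1.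
apply: le_trans (sum_sqr_le _ u0) _; apply: le_trans (exp_series_le _ D0 y1) _.
have -> : expR (D * y) - expR D = expR D * (z - 1).
  by rewrite mulrBr mulr1 /z -expRD (_ : D + D * (y - 1) = D * y) //; ring.
by rewrite ler_wpM2r // subr_ge0.
Qed.

(** * Integrals over a unit interval *)

(* Unlike ge0_le_integral, no measurability is needed. *)
Lemma le_integralT d (T : measurableType d) (R : realType)
    (mu : {measure set T -> \bar R}) (f g : T -> \bar R) :
  (forall x, (f x <= g x)%E) -> (\int[mu]_x f x <= \int[mu]_x g x)%E.
Proof.
move=> fg; rewrite /integral !patch_setT; apply: leeB; apply: ereal_sup_le.
- move=> _ [h hf <-]; exists h => // x; apply: le_trans (hf x) _.
  by apply: (@funepos_le _ _ setT) => //; rewrite inE.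
- move=> _ [h hg <-]; exists h => // x; apply: le_trans (hg x) _.
  by apply: (@funeneg_le _ _ setT) => //; rewrite inE.
Qed.

(** At each level the integrand is compared with [C] times the indicator of [I], whose integral is
    again [C] because [I] has measure 1. *)
Lemma iter_integral_le (R : realType) (I : set R) n (f : n.-tuple R -> \bar R)
    (C : R) : measurable I -> lebesgue_measure I = 1%E -> 0 <= C ->
  (forall x, (forall y, y \in x -> I y) -> (f x <= C%:E)%E) ->
  (forall x, ~ (forall y, y \in x -> I y) -> (f x <= 0)%E) ->
  (iter_integral f <= C%:E)%E.
Proof.
move=> mI I1; elim: n f C => [|n IH] f C C0 fC f0 /=; first exact: fC.
have -> : C%:E = (\int[lebesgue_measure]_x patch (fun=> 0%E) I (cst C%:E) x)%E.
  rewrite -integral_mkcond integral_cst // -[LHS]mule1.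
  by congr (_ * _)%E; exact: esym I1.
apply: (@le_integralT _ _ R lebesgue_measure) => x; rewrite patchE; case: ifPn => [|xI].
  rewrite inE => Ix; apply: IH => // y yI.
    by apply: fC => z; rewrite in_cons => /orP[/eqP ->//|]; exact: yI.
  by apply: f0 => yI'; apply: yI => z zy; apply: yI'; rewrite in_cons zy orbT.
(* Outside [I] the majorant is 0, and the induction hypothesis serves with constant 0. *)
rewrite notin_setE in xI; apply: IH => // y yI.
  by apply: f0 => yI'; apply: xI; apply: yI'; rewrite mem_head.
by apply: f0 => yI'; apply: xI; apply: yI'; rewrite mem_head.
Qed.

Lemma interval_dist_le (R : realType) (I : set R) (x y : R) :
  is_interval I -> lebesgue_measure I = 1%E -> I x -> I y -> `|y - x| <= 1.
Proof.
move=> iI I1; wlog xy : x y / x <= y.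
  move=> H Ix Iy; have [xy|/ltW yx] := leP x y; first exact: H.
  by rewrite distrC; exact: H.
move=> Ix Iy; rewrite ger0_norm ?subr_ge0 //.
move: xy; rewrite le_eqVlt => /orP[/eqP ->|xy]; first by rewrite subrr.
rewrite -lee_fin EFinB -I1.
have -> : (y%:E - x%:E = lebesgue_measure (`[x, y]%classic : set R))%E.
  by rewrite lebesgue_measure_itv /= lte_fin xy.
apply: le_measure; rewrite ?inE //; first exact: is_interval_measurable.
by move=> z /=; rewrite in_itv /= => ?; exact: (iI x y).
Qed.

(** * Law of the number of particles in a unit interval *)

Section Unit_interval.
Variables (R : realType) (P : probability (confM R) R) (I : set R).
Hypotheses (sP : symplectic_sine_process P) (iI : is_interval I).
Hypothesis I1 : lebesgue_measure I = 1%E.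

Let mI : measurable I. Proof. exact: is_interval_measurable. Qed.

(** The generating cylinders require bounded sets; [I] lies within distance 1 of any of its
    points. *)
Lemma measurable_npart k : measurable ([set X | npart I X = k] : set (confM R)).
Proof.
apply: sub_sigma_algebra; exists I, k; split => //.
have [I0|/set0P[x0 Ix0]] := eqVneq I set0.
  by move: I1; rewrite I0 measure0 => -[/eqP]; rewrite eq_sym oner_eq0.
exists (`|x0| + 1); split; first by rewrite num_real.
move=> M xM y Iy /=; apply: le_trans (ltW xM).
rewrite -{1}(subrK x0 y) addrC; apply: le_trans (ler_normD _ _) _.
by rewrite lerD2l (interval_dist_le iI I1).
Qed.

(** Guarantees that [npart I X] is the true count, as [fset_set] is empty on infinite sets. *)
Lemma finite_conf_interval (X : conf R) : finite_set (X `&` I).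
Proof.
have [I0|/set0P[x0 Ix0]] := eqVneq I set0; first by rewrite I0 setI0.
apply: sub_finite_set (conf_locally_finite X (@segment_compact _ (x0 - 1) (x0 + 1))).
move=> y [Xy Iy]; split => //=.
by rewrite in_itv /= -ler_distl (interval_dist_le iI I1).
Qed.

(** If #_I = n, the particles in [I] form an n-tuple of distinct points, so the probability is at
    most the integral of rho_n over I^n, which [Pf_K4_le] bounds after recentring at a point of
    [I]. *)
Lemma npart_prob_le : exists2 D : R, 1 <= D & forall n : nat,
  (P [set X | npart I X = n] <= (D ^+ (n ^ 2) / (n ^ 2)`!%:R)%:E)%E.
Proof.
have [D D1 HD] := Pf_K4_le R; exists D => // n.
have [I0|/set0P[x0 Ix0]] := eqVneq I set0.
  by move: I1; rewrite I0 measure0 => -[/eqP]; rewrite eq_sym oner_eq0.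
have D0 : 0 <= D ^+ (n ^ 2) / (n ^ 2)`!%:R.
  by rewrite divr_ge0 // exprn_ge0 // (le_trans _ D1).
pose f (x : n.-tuple R) : R := \prod_(i < n) \1_I (tnth x i).
have f0 x : 0 <= f x by apply: prodr_ge0 => i _; rewrite indicE.
have f1 (x : n.-tuple R) : (forall y, y \in x -> I y) -> f x = 1.
  by move=> xI; apply: big1 => i _; rewrite indicE mem_set //; apply: xI; rewrite mem_tnth.
have mf : measurable_fun [set: n.-tuple R] f.
  apply: measurable_prod => i _.
  by apply: measurableT_comp (measurable_tnth i); exact/measurable_indicP.
have PE : (P [set X | npart I X = n] <=
           \int[P]_X \esum_(x in distinct_tuples X) (f x)%:E)%E.
  rewrite -[in leLHS](setIT [set X | npart I X = n]).
  rewrite -integral_indic //; last exact: measurable_npart.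
  apply: le_integralT => X; rewrite indicE; case: (boolP (X \in _)); last first.
    by move=> _; apply: esum_ge0 => x _; rewrite lee_fin.
  rewrite inE /npart /= => /eqP sX.
  have fX := finite_conf_interval X.
  pose t : n.-tuple R := Tuple sX.
  have tX y : y \in t -> (X `&` I) y 
    by move=> yt; have : y \in fset_set (X `&` I) := yt; rewrite in_fset_set // inE.
  (* Among the orderings of the n particles, a single one already contributes 1. *)
  apply: esum_ge; exists [set t].
    split; first exact: finite_set1.
    move=> _ ->; split; first exact: fset_uniq.
    by move=> i; apply: (tX _ (mem_tnth i t)).1.
  by rewrite fsbig_set1 f1 // => y /tX[].
apply: (le_trans PE).
rewrite (sP mf f0); apply: (iter_integral_le mI I1 D0) => x xI; rewrite lee_fin.
  rewrite f1 // mul1r; apply: le_trans (ler_norm _) (HD n x0 x _).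
  by move=> y /xI Iy; exact: (interval_dist_le iI I1).
rewrite [f x](_ : _ = 0) ?mul0r //.
have [y yx yI] : exists2 y, y \in x & ~ I y.
  by apply: contrapT => H; apply: xI => y yx; apply: contrapT => yI; apply: H; exists y.
have /tnthP[i yE] := yx.
by rewrite /f (bigD1 i) //= indicE -yE memNset // mul0r.
Qed.

(** The level sets of [npart I] form a countable measurable partition on which the integrand is
    constant. *)
Lemma expectation_npart (g : nat -> R) : (forall k, 0 <= g k) ->
  ('E_P[fun X => g (npart I X)] =
   \sum_(k <oo) (g k)%:E * P [set X | npart I X = k])%E.
Proof.
move=> g0; pose A k : set (confM R) := [set X | npart I X = k].
have AT : \bigcup_k A k = setT.
  by apply/seteqP; split => // X _; exists (npart I X).
have mA k : measurable (A k) by exact: measurable_npart.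
have mg : measurable_fun setT ((fun X => (g (npart I X))%:E) : confM R -> \bar R).
  move=> _ Y mY; rewrite setTI.
  have -> : (fun X => (g (npart I X))%:E) @^-1` Y =
            \bigcup_(k in [set k | Y (g k)%:E]) A k.
    apply/seteqP; split => [X YX|X [k Yk Xk]]; first by exists (npart I X).
    by rewrite /= [npart I X]Xk.
  exact: bigcup_measurable.
rewrite expectation.unlock -AT ge0_integral_bigcup //.
- apply: eq_eseriesr => k _.
  rewrite (eq_integral (cst (g k)%:E)) ?integral_cst //.
  by move=> X /set_mem Xk; rewrite /= [npart I X]Xk.
- exact: measurable_funS mg.
- by move=> X _; rewrite lee_fin.
- by move=> i j _ _ [X []]; rewrite /A /= => -> .
Qed.

Lemma sum_npart_prob_le1 m :
  \sum_(0 <= k < m) fine (P [set X | npart I X = k]) <= 1.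
Proof.
have mA k : measurable ([set X | npart I X = k] : set (confM R)).
  exact: measurable_npart.
rewrite -lee_fin -sumEFin big_mkord.
under eq_bigr => k _ do rewrite fineK ?fin_num_measure //.
rewrite -(@measure_bigsetU_ord _ _ _ P m xpredT
  (fun k => [set X | npart I X = k] : set (confM R))) //.
  by apply: probability_le1; exact: bigsetU_measurable.
by move=> i j _ _ [X []] /= Xi Xj; apply: val_inj; rewrite /= -Xi.
Qed.

End Unit_interval.

Theorem theorem2 (R : realType) (P : probability (confM R) R) (I : set R) :
  symplectic_sine_process P ->
  is_interval I -> lebesgue_measure I = 1%E ->
  exists2 c1 : R, 0 < c1 &
    forall lambda : R, 0 < lambda ->
      ('E_P[fun X => expR (lambda * (npart I X)%:R ^+ 2)] <=
       (expR (c1 * (expR lambda - 1)))%:E)%E.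
Proof.
move=> sP iI I1; have [D D1 HD] := npart_prob_le sP iI I1.
have D0 : 0 < D by exact: lt_le_trans D1.
(* The constant of [sum_sqr_exp_le]; it depends on [D] alone, not on [lambda]. *)
exists ((Num.trunc (expR D)).+1%:R * D) => [|lambda l0]; first by rewrite mulr_gt0.
pose p k := fine (P [set X | npart I X = k]).
have pE k : P [set X | npart I X = k] = (p k)%:E.
  by rewrite fineK // fin_num_measure //; exact: measurable_npart.
have y1 : 1 <= expR lambda by rewrite -[leLHS](expR0 R) ler_expR ltW.
have -> : (fun X : confM R => expR (lambda * (npart I X)%:R ^+ 2)) =
          (fun X => expR lambda ^+ (npart I X ^ 2)).
  by apply/funext => X; rewrite -natrX expRM_natr.
rewrite (@expectation_npart _ P I iI I1 (fun k => expR lambda ^+ (k ^ 2))); last first.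
  by move=> k; rewrite exprn_ge0 ?expR_ge0.
(* The expectation is a limit of partial sums, so a bound uniform in their length suffices. *)
apply: lime_le.
  by apply: is_cvg_nneseries => k _ _; rewrite mule_ge0 // lee_fin exprn_ge0 ?expR_ge0.
near=> m; under eq_bigr => k _ do rewrite pE -EFinM.
rewrite sumEFin lee_fin; apply: sum_sqr_exp_le => //; first exact: ltW.
  by move=> k; rewrite -lee_fin -pE.
exact: sum_npart_prob_le1.
Unshelve. all: by end_near.
Qed.
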